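(* Let $n$ and $p$ be integers with $n\ge p+1$ and $p\ge 3$. Then $$\operatorname{ar}(n,\mathcal{F}^{(p)})=1+\lfloor n/p\rfloor .$$ Furthermore, for every extremal coloring, i.e. every rainbow $\mathcal{F}^{(p)}$-free edge-coloring of $K_n^{(p)}$ using exactly $\operatorname{ar}(n,\mathcal{F}^{(p)})$ colors, there is a vertex subset $U$ with $|U|=p\lfloor n/p\rfloor$ such that $K_n^{(p)}[U]$ contains $\lfloor n/p\rfloor$ pairwise vertex-disjoint edges which receive pairwise distinct colors, and every other edge of $K_n^{(p)}[U]$ receives one additional common color (different from the colors of those $\lfloor n/p\rfloor$ edges).
   Context: A $p$-graph is a $p$-uniform hypergraph, and $K_n^{(p)}$ is the complete $p$-graph on $n$ vertices (all $p$-subsets of an $n$-set are edges). For a vertex subset $U$, $K_n^{(p)}[U]$ is the induced sub-$p$-graph, i.e. all $p$-subsets of $U$. An edge-coloring of a $p$-graph $H$ is a surjection from $E(H)$ onto a set of colors; the number of colors used is the size of this set. A sub-$p$-graph is rainbow if its edges receive pairwise distinct colors. For a family $\mathcal{F}$ of $p$-graphs, an edge-colored $p$-graph is rainbow $\mathcal{F}$-free if it contains no rainbow copy of any member of $\mathcal{F}$. The anti-Ramsey number $\operatorname{ar}(n,\mathcal{F})$ is the maximum number of colors in a rainbow $\mathcal{F}$-free edge-coloring of $K_n^{(p)}$. $\mathcal{F}^{(p)}$ is the family of $p$-graphs consisting of three distinct edges $A,B,C$ with $A\triangle B\subseteq C$, where $\triangle$ is symmetric difference. *)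

(* Defs.v *)
From mathcomp Require Import all_boot.

Set Implicit Arguments.
Unset Strict Implicit.
Unset Printing Implicit Defensive.

Record pgraph (p : nat) := PGraph {
  vertex : finType;
  edges : {set {set vertex}};
  edges_uniform : forall e, e \in edges -> #|e| = p
}.

Lemma complete_uniform (n p : nat) (e : {set 'I_n}) :
  e \in [set e' : {set 'I_n} | #|e'| == p] -> #|e| = p.
Proof. by rewrite inE => /eqP. Qed.

Definition complete (n p : nat) : pgraph p :=
  PGraph (@complete_uniform n p).

(* Edge set of H[U]; it is kept over the vertex type of H, so that a coloring
   of H restricts to it without transport. *)
Definition induced_edges (p : nat) (H : pgraph p) (U : {set vertex H}) :
  {set {set vertex H}} := [set e in edges H | e \subset U].

(* Colorings are total on vertex sets, but every notion below only inspects
   their values on edges.  The color set is the whole type K, so the number of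
   colors used is #|K|. *)
Definition edge_coloring (p : nat) (H : pgraph p) (K : finType)
    (c : {set vertex H} -> K) : Prop :=
  forall k : K, exists2 e, e \in edges H & c e = k.

Definition embedding (p : nat) (F H : pgraph p)
    (f : vertex F -> vertex H) : Prop :=
  injective f /\ (forall e, e \in edges F -> f @: e \in edges H).

Definition rainbow_copy (p : nat) (F H : pgraph p) (K : finType)
    (c : {set vertex H} -> K) (f : vertex F -> vertex H) : Prop :=
  embedding f /\ {in edges F &, injective (fun e : {set vertex F} => c (f @: e))}.

Definition rainbow_free (p : nat) (Fam : pgraph p -> Prop) (H : pgraph p)
    (K : finType) (c : {set vertex H} -> K) : Prop :=
  forall F : pgraph p, Fam F ->
  ~ exists f : vertex F -> vertex H, rainbow_copy c f.

(* m = ar(n, Fam), the maximum being spelled out as attained upper bound. *)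
Definition is_anti_ramsey (n p : nat) (Fam : pgraph p -> Prop) (m : nat) :
    Prop :=
  (exists (K : finType) (c : {set vertex (complete n p)} -> K),
     [/\ edge_coloring c, rainbow_free Fam c & #|K| = m]) /\
  (forall (K : finType) (c : {set vertex (complete n p)} -> K),
     edge_coloring c -> rainbow_free Fam c -> #|K| <= m).

Definition symdiff (T : finType) (A B : {set T}) : {set T} :=
  (A :\: B) :|: (B :\: A).

(* The covering condition says that members have no isolated vertices. *)
Definition triangle_family (p : nat) (F : pgraph p) : Prop :=
  cover (edges F) = [set: vertex F] /\
  exists A B C : {set vertex F},
    [/\ uniq [:: A; B; C], edges F = [set A; B; C] & symdiff A B \subset C].

(* Main.v *)
Require Import Defs.
From mathcomp Require Import all_boot.

(** The theorem is a consequence of a description of all colorings without a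
    rainbow member of the family: some color [k0], the hub, is such that any two
    edges having distinct colors, both different from [k0], are disjoint
    ([hub_of_rainbow_free]); conversely a hub excludes rainbow copies
    ([hub_rainbow_free]). Given a hub, one edge of each other color yields a
    matching, so there are at most [n %/ p] other colors, and coloring
    [n %/ p] disjoint blocks differently and everything else with [k0] attains
    the bound. In an extremal coloring take [U] to be the union of such a
    matching. An edge inside [U] of color [k <> k0] is disjoint from all members
    of the matching except the one of color [k], hence it equals that one.

    To find the hub, start from the case where [A] and [B] differ by one
    exchange, [A = S + x] and [B = S + y]: if their colors differ, every edge
    through [x] and [y] has one of these two colors ([split_confined]).
    Everything else follows from this.
    - If two edges through [u] have distinct colors, then both colors occur
      inside some set of size [p + 1] containing [u] ([meeting_edges_split]),
      and therefore, for some [w], all edges through [u] and [w] have one of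
      these two colors ([meeting_edges_confined]).
    - Three colors at [u] would give three such pairs at [u]. A set of size
      [p + 1] containing all of them would show three colors, which is
      impossible ([two_colors_at_vertex]).
    - Fix a vertex [u]. An edge [C] whose color is absent at [u] keeps a single
      color under every exchange of one of its vertices for [u], and this
      color does not depend on [C] ([unseen_swap_color]). It is the hub
      ([hub_exists]). *)

Set Implicit Arguments.
Unset Strict Implicit.
Unset Printing Implicit Defensive.

(** * Finite combinatorics *)

Lemma exists_superset_card (T : finType) (D : {set T}) (m : nat) :
  #|D| <= m <= #|T| -> exists2 E : {set T}, D \subset E & #|E| = m.
Proof.
case/andP; elim: m => [|m IHm].
  by rewrite leqn0 => /eqP D0 _; exists D.
rewrite leq_eqVlt => /orP[/eqP DmS _|]; first by exists D.
rewrite ltnS => Dm mT; have [E DE Em] := IHm Dm (ltnW mT).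
have [x xE] : exists x, x \in ~: E.
  by apply/set0Pn; rewrite -card_gt0 -(ltn_add2l #|E|) cardsC addn0 Em.
exists (x |: E); first by rewrite (subset_trans DE) ?subsetUr.
by rewrite cardsU1 Em; move: xE; rewrite inE => ->.
Qed.

Lemma not_uniq3 (K : eqType) (i j k : K) :
  ~~ uniq [:: i; j; k] -> [\/ i = j, i = k | j = k].
Proof.
rewrite /= !inE andbT negb_and !negbK.
by case/orP=> [/orP[]|] /eqP; [apply: Or31|apply: Or32|apply: Or33].
Qed.

(** * Colorings without rainbow generalized triangles *)

Section RainbowTriangleFree.

Variables (T : finType) (K : eqType) (p : nat) (c : {set T} -> K).

Definition triangle_free : Prop := forall A B C : {set T},
  #|A| = p -> #|B| = p -> #|C| = p -> symdiff A B \subset C ->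
  ~~ uniq [:: c A; c B; c C].

(** The colors [i] and [j] need not both occur on edges through [x] and [y]. *)
Definition confined (x y : T) (i j : K) : Prop := forall e : {set T},
  #|e| = p -> x \in e -> y \in e -> c e = i \/ c e = j.

Hypothesis free : triangle_free.
Hypothesis p_ge3 : 2 < p.
Hypothesis p_ltT : p < #|T|.

Implicit Types (A B C D E Z S e : {set T}) (x y u : T).

Lemma card_delete Z x : #|Z| = p.+1 -> x \in Z -> #|Z :\ x| = p.
Proof. by move=> Zp xZ; apply/succn_inj; rewrite -Zp (cardsD1 x Z) xZ. Qed.

(** Two edges inside a set [Z] of size [p + 1] have the form [Z :\ x], [Z :\ y]
    and symmetric difference [{x, y}], so an edge through [x] and [y] can serve
    as the third edge of a triangle. Exchanging one vertex is always expressed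
    this way below. *)
Lemma split_confined Z x y : #|Z| = p.+1 -> x \in Z -> y \in Z ->
  c (Z :\ x) <> c (Z :\ y) -> confined x y (c (Z :\ x)) (c (Z :\ y)).
Proof.
move=> Zp xZ yZ nxy e ep xe ye.
have : ~~ uniq [:: c (Z :\ x); c (Z :\ y); c e].
  apply: free; rewrite ?card_delete //; apply/subsetP=> z; rewrite !inE.
  by case: (eqVneq z x) => [->|_] //; case: (eqVneq z y) => [->|_] //; case: (z \in Z).
by case/not_uniq3; auto.
Qed.

Lemma two_colors_on_card_pS Z x y z : #|Z| = p.+1 -> x \in Z -> y \in Z -> z \in Z ->
  c (Z :\ x) <> c (Z :\ y) -> c (Z :\ z) = c (Z :\ x) \/ c (Z :\ z) = c (Z :\ y).
Proof.
move=> Zp xZ yZ zZ nxy.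
case: (eqVneq z x) => [->|zx]; first by left.
case: (eqVneq z y) => [->|zy]; first by right.
apply: (split_confined Zp xZ yZ nxy); rewrite ?card_delete // !inE.
  by rewrite eq_sym zx xZ.
by rewrite eq_sym zy yZ.
Qed.

Lemma exists_edge_through3 x y z : exists e, [/\ #|e| = p, x \in e, y \in e & z \in e].
Proof.
have [|e /subsetP De ep] := @exists_superset_card T [set x; y; z] p.
  rewrite (ltnW p_ltT) andbT; apply: leq_trans p_ge3.
  apply: leq_trans (leq_card_setU _ _) _; rewrite cards1 cards2.
  by case: eqP.
by exists e; split=> //; apply: De; rewrite !inE eqxx ?orbT.
Qed.

Lemma add_confined S x y : #|S|.+1 = p -> x \notin S -> y \notin S ->
  c (x |: S) <> c (y |: S) -> confined x y (c (x |: S)) (c (y |: S)).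
Proof.
move=> Sp xS yS nxy.
have xy : x != y by apply: contra_notN nxy => /eqP ->.
have yxS : y \notin x |: S by rewrite !inE eq_sym negb_or xy.
have dx : (x |: (y |: S)) :\ x = y |: S.
  by rewrite setU1K // !inE negb_or xy.
have dy : (x |: (y |: S)) :\ y = x |: S by rewrite setUCA setU1K.
have := @split_confined (x |: (y |: S)) y x; rewrite dx dy.
rewrite !inE !eqxx orbT setUCA !cardsU1 yxS xS; move=> H e ep xe ye.
by apply: (H _ isT isT nxy e ep ye xe); rewrite -Sp.
Qed.

(** With three colors every pair among [x], [y], [z] would be confined to two
    of them, leaving no color for an edge through all three vertices, which
    exists as [p >= 3]. *)
Lemma two_colors_on_star S x y z : #|S|.+1 = p ->
  x \notin S -> y \notin S -> z \notin S ->
  ~~ uniq [:: c (x |: S); c (y |: S); c (z |: S)].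
Proof.
move=> Sp xS yS zS; apply/negP; rewrite /= !inE negb_or.
case/andP=> /andP[/eqP nxy /eqP nxz] /andP[/eqP nyz _].
have [e [ep xe ye ze]] := exists_edge_through3 x y z.
have := add_confined Sp xS yS nxy ep xe ye.
have := add_confined Sp xS zS nxz ep xe ze.
have := add_confined Sp yS zS nyz ep ye ze.
by case=> [] ->; case=> [] ?; case; congruence.
Qed.

(** Exchange a vertex [a] of [A] for a vertex [b] of [B], or the other way
    round. If the new edge has one of the two given colors, either the desired
    [Z] is found or the pair can be replaced by a closer one still meeting in
    [u]. Otherwise [{a, b}] is confined by both exchanges, and the edge
    [b |: A :\ u] through [a] and [b] can have neither given color; compared
    with [A] it confines [{b, u}], a pair contained in [B], whose color is then
    left out. *)
Lemma meeting_edges_split u A B : #|A| = p -> #|B| = p ->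
    u \in A -> u \in B -> c A <> c B ->
  exists Z x y, [/\ #|Z| = p.+1, [/\ u \in Z, x \in Z & y \in Z],
    c (Z :\ x) = c A & c (Z :\ y) = c B].
Proof.
have [n] := ubnP #|A :\: B|; elim: n A B => // n IHn A B; rewrite ltnS => ABn.
move=> Ap Bp uA uB nAB.
have [AB|[a]] := set_0Vmem (A :\: B).
  have /eqP E : A == B by rewrite eqEcard -setD_eq0 AB eqxx Ap Bp /=.
  by rewrite E in nAB.
rewrite inE => /andP[aB aA].
have [BA|[b]] := set_0Vmem (B :\: A).
  have /eqP E : B == A by rewrite eqEcard -setD_eq0 BA eqxx Ap Bp /=.
  by rewrite E in nAB.
rewrite inE => /andP[bA bB].
have ua : u != a by apply: contraNneq aB => <-.
have ub : u != b by apply: contraNneq bA => <-.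
have ab : a != b by apply: contraNneq bA => <-.
pose ZA := b |: A; pose ZB := a |: B.
have ZAp : #|ZA| = p.+1 by rewrite cardsU1 bA Ap.
have ZBp : #|ZB| = p.+1 by rewrite cardsU1 aB Bp.
have dA : ZA :\ b = A by rewrite setU1K.
have dB : ZB :\ a = B by rewrite setU1K.
have [uZA aZA bZA] : [/\ u \in ZA, a \in ZA & b \in ZA].
  by rewrite !inE uA aA eqxx !orbT.
have [uZB aZB bZB] : [/\ u \in ZB, a \in ZB & b \in ZB].
  by rewrite !inE uB bB eqxx !orbT.
have smaller : #|A :\: B :\ a| < n.
  by move: ABn; rewrite (cardsD1 a) inE aA aB.
have [EA|/eqP nA] := eqVneq (c (ZA :\ a)) (c B).
  by exists ZA, b, a; rewrite dA; split.
have [EB|/eqP nB] := eqVneq (c (ZB :\ b)) (c A).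
  by exists ZB, b, a; rewrite dB; split.
have [EA|/eqP nA'] := eqVneq (c (ZA :\ a)) (c A).
  rewrite -EA; apply: IHn; rewrite ?card_delete // ?inE ?ua ?uA ?orbT //.
  apply: leq_ltn_trans smaller; apply/subset_leq_card/subsetP=> z; rewrite !inE.
  by case: (eqVneq z b) => [->|_]; rewrite ?bB ?andbF //= => /andP[-> /andP[-> ->]].
have [EB|/eqP nB'] := eqVneq (c (ZB :\ b)) (c B).
  rewrite -EB; apply: IHn; rewrite ?card_delete // ?inE ?ub ?uB ?orbT //; last by rewrite EB.
  apply: leq_ltn_trans smaller; apply/subset_leq_card/subsetP=> z; rewrite !inE.
  case: (eqVneq z b) => [->|_]; first by rewrite (negPf bA) andbF.
  by rewrite /= negb_or -andbA.
(* The edge exchanging [u] itself for [b] contains the pair [a], [b]. *)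
have [Du Dua Dub] : [/\ #|ZA :\ u| = p, a \in ZA :\ u & b \in ZA :\ u].
  by rewrite card_delete // !inE ![_ == u]eq_sym ua ub aA eqxx orbT.
have cA : c (ZA :\ a) <> c (ZA :\ b) by rewrite dA.
have cB : c (ZB :\ b) <> c (ZB :\ a) by rewrite dB.
have HA := split_confined ZAp aZA bZA cA Du Dua Dub.
have HB := split_confined ZBp bZB aZB cB Du Dub Dua.
rewrite dA in HA; rewrite dB in HB.
have cu : c (ZA :\ u) <> c (ZA :\ b).
  by rewrite dA; case: HB => ->; congruence.
have := split_confined ZAp uZA bZA cu Bp uB bB; rewrite dA.
by case: HA => ->; case: HB => ?; case; congruence.
Qed.

(** In the set [Z] given by the previous lemma, [Z :\ u] has one of the two
    colors, hence differs in color from [Z :\ w] for some [w]. *)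
Lemma meeting_edges_confined u A B : #|A| = p -> #|B| = p ->
  u \in A -> u \in B -> c A <> c B -> exists w, confined u w (c A) (c B).
Proof.
move=> Ap Bp uA uB nAB.
have [Z [x [y [Zp [uZ xZ yZ] EA EB]]]] := meeting_edges_split Ap Bp uA uB nAB.
have nxy : c (Z :\ x) <> c (Z :\ y) by rewrite EA EB.
have [Eu|Eu] := two_colors_on_card_pS Zp xZ yZ uZ nxy.
  exists y; have := @split_confined Z u y Zp uZ yZ.
  by rewrite Eu EA EB; apply.
exists x; have := @split_confined Z x u Zp xZ uZ.
by rewrite Eu EA EB => H e ep ue xe; apply: (H nAB).
Qed.

(** Three colors at [u] give vertices [x], [y], [z] such that the pairs [ux],
    [uy], [uz] are confined to the three pairs of colors, so no edge contains
    all of [u], [x], [y], [z]. This already fails if two of these vertices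
    coincide. Otherwise a set of size [p + 1] containing them becomes, on
    deletion of [x], [y] or [z], an edge of each of the three colors. *)
Lemma two_colors_at_vertex u A B C : #|A| = p -> #|B| = p -> #|C| = p ->
  u \in A -> u \in B -> u \in C -> ~~ uniq [:: c A; c B; c C].
Proof.
move=> Ap Bp Cp uA uB uC; apply/negP; rewrite /= !inE negb_or.
case/andP=> /andP[/eqP nAB /eqP nAC] /andP[/eqP nBC _].
have [x Hx] := meeting_edges_confined Ap Bp uA uB nAB.
have [y Hy] := meeting_edges_confined Ap Cp uA uC nAC.
have [z Hz] := meeting_edges_confined Bp Cp uB uC nBC.
have conflict e : #|e| = p -> u \in e -> x \in e -> y \in e -> z \in e -> False.
  move=> ep ue xe ye ze; have := Hx e ep ue xe; have := Hy e ep ue ye.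
  by have := Hz e ep ue ze; case=> ->; case=> ?; case; congruence.
have [xy|xy] := eqVneq x y.
  have [e [ep ue xe ze]] := exists_edge_through3 u x z.
  by apply: (conflict e); rewrite -?xy.
have [xz|xz] := eqVneq x z.
  have [e [ep ue xe ye]] := exists_edge_through3 u x y.
  by apply: (conflict e); rewrite -?xz.
have [yz|yz] := eqVneq y z.
  have [e [ep ue xe ye]] := exists_edge_through3 u x y.
  by apply: (conflict e); rewrite -?yz.
have xu : x != u.
  apply/eqP=> xu; have [e [ep ue ye ze]] := exists_edge_through3 u y z.
  by apply: (conflict e); rewrite ?xu.
have yu : y != u.
  apply/eqP=> yu; have [e [ep ue xe ze]] := exists_edge_through3 u x z.
  by apply: (conflict e); rewrite ?yu.
have zu : z != u.
  apply/eqP=> zu; have [e [ep ue xe ye]] := exists_edge_through3 u x y.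
  by apply: (conflict e); rewrite ?zu.
have [|Z DZ Zp] := @exists_superset_card T (u |: [set x; y; z]) p.+1.
  rewrite p_ltT andbT; apply: leq_trans (_ : 4 <= _); last exact: p_ge3.
  apply: leq_trans (leq_card_setU _ _) _; rewrite cards1 ltnS.
  apply: leq_trans (leq_card_setU _ _) _; rewrite cards1 cards2.
  by case: eqP.
have [uZ xZ yZ zZ] : [/\ u \in Z, x \in Z, y \in Z & z \in Z].
  by split; apply: (subsetP DZ); rewrite !inE eqxx ?orbT.
have uD w : w != u -> u \in Z :\ w by rewrite !inE eq_sym => ->.
have wD v w : v != w -> v \in Z -> v \in Z :\ w by rewrite !inE => -> ->.
have Ex : c (Z :\ x) = c C.
  have := Hy _ (card_delete Zp xZ) (uD _ xu); rewrite wD 1?eq_sym // => /(_ isT).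
  have := Hz _ (card_delete Zp xZ) (uD _ xu); rewrite wD 1?eq_sym // => /(_ isT).
  by case=> [] ->; case=> ?; congruence.
have Ey : c (Z :\ y) = c B.
  have := Hx _ (card_delete Zp yZ) (uD _ yu); rewrite wD // => /(_ isT).
  have := Hz _ (card_delete Zp yZ) (uD _ yu); rewrite wD 1?eq_sym // => /(_ isT).
  by case=> [] ->; case=> ?; congruence.
have Ez : c (Z :\ z) = c A.
  have := Hx _ (card_delete Zp zZ) (uD _ zu); rewrite wD // => /(_ isT).
  have := Hy _ (card_delete Zp zZ) (uD _ zu); rewrite wD // => /(_ isT).
  by case=> [] ->; case=> ?; congruence.
have nxy : c (Z :\ x) <> c (Z :\ y) by rewrite Ex Ey; congruence.
have := two_colors_on_card_pS Zp xZ yZ zZ nxy; rewrite Ex Ey Ez.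
by case; congruence.
Qed.

Definition unseen (u : T) (k : K) : Prop :=
  forall e, #|e| = p -> u \in e -> c e <> k.

(** Since [C = (u |: C) :\ u] differs in color from [(u |: C) :\ x], the pair
    [{u, x}] is confined to these two colors, of which only the second occurs
    at [u]; similarly for [D] and [y]. An edge through [u], [x], [y] thus has
    both colors of the conclusion. *)
Lemma unseen_swap_color u C D x y : #|C| = p -> #|D| = p ->
  unseen u (c C) -> unseen u (c D) -> x \in C -> y \in D ->
  c ((u |: C) :\ x) = c ((u |: D) :\ y).
Proof.
move=> Cp Dp unC unD xC yD; apply/eqP; apply: contraT => /eqP nCD.
have setup E w : #|E| = p -> unseen u (c E) -> w \in E ->
    [/\ #|(u |: E) :\ w| = p, u \in (u |: E) :\ w & 
        confined u w (c E) (c ((u |: E) :\ w))].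
  move=> Ep unE wE.
  have uE : u \notin E by apply/negP=> /(unE _ Ep).
  have Zp : #|u |: E| = p.+1 by rewrite cardsU1 uE Ep.
  have du : (u |: E) :\ u = E by rewrite setU1K.
  have [uZ wZ] : u \in u |: E /\ w \in u |: E by rewrite !inE wE eqxx !orbT.
  have ux : u \in (u |: E) :\ w.
    by rewrite !inE eqxx andbT; apply: contraNneq uE => ->.
  have Dp' := card_delete Zp wZ.
  split=> //; have := @split_confined (u |: E) u w Zp uZ wZ.
  by rewrite du; apply; apply: nesym; apply: unE.
have [Cxp uCx HC] := setup C x Cp unC xC.
have [Dyp uDy HD] := setup D y Dp unD yD.
have [e [ep ue xe ye]] := exists_edge_through3 u x y.
have nC := unC e ep ue; have nD := unD e ep ue.
by case: (HC e ep ue xe) => // EC; case: (HD e ep ue ye) => // ED; congruence.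
Qed.

(** The edges [C], [D] and [(u |: C) :\ x] all extend [C :\ x] by one vertex,
    so at most two colors occur among them, and the third edge cannot have the
    color of [C]. *)
Lemma unseen_neighbor_color u C D x y : #|C| = p -> unseen u (c C) -> x \in C ->
    #|D| = p -> y \in D -> c D <> c C -> D :\ y = C :\ x ->
  c D = c ((u |: C) :\ x).
Proof.
move=> Cp unC xC Dp yD nDC E.
have uC : u \notin C by apply/negP=> /(unC _ Cp).
have ux : u != x by apply: contraNneq uC => ->.
have Sp : #|C :\ x|.+1 = p by rewrite -Cp (cardsD1 x C) xC.
have := @two_colors_on_star (C :\ x) x y u Sp.
have -> : u |: (C :\ x) = (u |: C) :\ x.
  by apply/setP=> z; rewrite !inE; case: (eqVneq z u) => [->|]; rewrite ?ux.
have -> : y |: (C :\ x) = D by rewrite -E setD1K.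
have -> : y \notin C :\ x by rewrite -E !inE eqxx.
rewrite setD1K // !inE eqxx (negPf uC) andbF.
move=> /(_ isT isT isT) /not_uniq3[] // EE; first by case: nDC.
exfalso; apply: (unC ((u |: C) :\ x)) => //.
  by rewrite card_delete // ?inE ?xC ?orbT // cardsU1 uC Cp.
by rewrite !inE eqxx ux.
Qed.

(** If all colors occur at [u] there are at most two of them and any one
    is a hub. Otherwise the hub is the color that all edges with a color absent
    at [u] acquire by an exchange for [u]: two meeting edges with colors
    [i <> j], both different from the hub, may be assumed to differ by one
    exchange, so neither color is absent at [u], and [i], [j] and the hub would
    be three colors at [u]. *)
Theorem hub_exists : exists k0 : K, forall A B, #|A| = p -> #|B| = p ->
  c A <> c B -> c A <> k0 -> c B <> k0 -> [disjoint A & B].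
Proof.
have [u _] : exists u : T, u \in [set: T].
  by apply/set0Pn; rewrite -card_gt0 cardsT (leq_trans _ p_ltT).
have [e0 [e0p ue0 _ _]] := exists_edge_through3 u u u.
pose unseenb k := [forall e : {set T}, (#|e| == p) ==> (u \in e) ==> (c e != k)].
have unseenP k : reflect (unseen u k) (unseenb k).
  apply: (iffP forallP) => [H e ep ue|H e].
    by apply/eqP; have := H e; rewrite ep eqxx ue.
  by apply/implyP=> /eqP ep; apply/implyP=> ue; apply/eqP; apply: H.
have seenP k : ~~ unseenb k -> exists e, [/\ #|e| = p, u \in e & c e = k].
  case/forallPn=> e; rewrite negb_imply => /andP[/eqP ep].
  by rewrite negb_imply negbK => /andP[ue /eqP ek]; exists e.
have seen_disjoint k0 A B : ~~ unseenb k0 -> ~~ unseenb (c A) -> ~~ unseenb (c B) ->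
    c A <> c B -> c A <> k0 -> c B <> k0 -> [disjoint A & B].
  move=> /seenP[e [ep ue <-]] /seenP[A' [Ap uA <-]] /seenP[B' [Bp uB <-]].
  move=> /eqP nAB /eqP nA /eqP nB.
  have := two_colors_at_vertex Ap Bp ep uA uB ue.
  by rewrite /= !inE negb_or nAB nA nB.
have seen0 e : #|e| = p -> u \in e -> ~~ unseenb (c e).
  by move=> ep ue; apply/unseenP => /(_ e ep ue).
have [/existsP[C /andP[/eqP Cp /unseenP unC]]|] :=
    boolP [exists C : {set T}, (#|C| == p) && unseenb (c C)]; last first.
  rewrite negb_exists => /forallP allseen; exists (c e0) => A B Ap Bp.
  apply: (seen_disjoint _ A B (seen0 e0 e0p ue0)).
    by have := allseen A; rewrite Ap eqxx.
  by have := allseen B; rewrite Bp eqxx.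
have [x0 x0C] : exists x, x \in C by apply/set0Pn; rewrite -card_gt0 Cp (leq_trans _ p_ge3).
have uC : u \notin C by apply/negP=> /(unC _ Cp).
have seenh : ~~ unseenb (c ((u |: C) :\ x0)).
  apply: seen0; last by rewrite !inE eqxx andbT; apply: contraNneq uC => ->.
  by rewrite card_delete // ?cardsU1 ?uC ?Cp // !inE x0C orbT.
exists (c ((u |: C) :\ x0)).
have swap_hub D x : #|D| = p -> unseen u (c D) -> x \in D ->
    c ((u |: D) :\ x) = c ((u |: C) :\ x0).
  by move=> Dp unD xD; apply: unseen_swap_color.
have meet_seen A B v : #|A| = p -> #|B| = p -> v \in A -> v \in B -> c A <> c B ->
    c B <> c ((u |: C) :\ x0) -> ~~ unseenb (c A).
  move=> Ap Bp vA vB nAB nB; apply/negP=> /unseenP unA; apply: nB.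
  have [Z [x [y [Zp [_ xZ yZ] EA EB]]]] := meeting_edges_split Ap Bp vA vB nAB.
  have xy : x != y by apply: contra_notN nAB => /eqP E; rewrite -EA -EB E.
  rewrite -EA in unA; have yA : y \in Z :\ x by rewrite !inE eq_sym xy.
  rewrite -EB -(swap_hub _ y (card_delete Zp xZ) unA yA).
  apply: (@unseen_neighbor_color u (Z :\ x) (Z :\ y) y x);
    rewrite ?card_delete ?inE ?xy //.
  - by rewrite eq_sym xy.
  - by rewrite EA EB => EE; apply: nAB.
  - by rewrite setDDl setUC -setDDl.
move=> A B Ap Bp nAB nA nB; have [AB0|[v]] := set_0Vmem (A :&: B).
  by rewrite -setI_eq0 AB0.
rewrite inE => /andP[vA vB].
have sA := meet_seen A B v Ap Bp vA vB nAB nB.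
have sB := meet_seen B A v Bp Ap vB vA (nesym nAB) nA.
exact: (seen_disjoint _ A B seenh sA sB).
Qed.

End RainbowTriangleFree.

(** * Rainbow copies and hubs *)

(** The forbidden hypergraph with edges [A], [B], [C] is taken on the vertex set
    [A :|: B :|: C], as a member of the family has no isolated vertex. *)
Lemma rainbow_free_triangle_free (n p : nat) (K : finType)
    (c : {set vertex (complete n p)} -> K) :
  rainbow_free (@triangle_family p) c -> triangle_free p c.
Proof.
move=> free A B C Ap Bp Cp ABC; apply/negP=> /= uniqc.
have := uniqc; rewrite !inE negb_or andbT.
case/andP=> /andP[nAB nAC] nBC.
pose V : finType := {x : 'I_n | x \in A :|: B :|: C}.
pose pre (X : {set 'I_n}) := [set v : V | val v \in X].
have preK (X : {set 'I_n}) : X \subset A :|: B :|: C -> val @: pre X = X.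
  move=> XD; apply/setP=> x; apply/imsetP/idP=> [[v]|xX].
    by rewrite inE => vX ->.
  by exists (Sub x (subsetP XD x xX)); rewrite ?inE SubK.
have [AD BD CD] : [/\ val @: pre A = A, val @: pre B = B & val @: pre C = C].
  by split; apply: preK; apply/subsetP=> x xX; rewrite !inE xX ?orbT.
have unif (e : {set V}) : e \in [set pre A; pre B; pre C] -> #|e| = p.
  by rewrite !inE => /orP[/orP[]|] /eqP ->;
    rewrite -(card_imset _ val_inj) ?AD ?BD ?CD.
apply: (free (PGraph unif)).
  split=> /=.
    apply/setP=> v; rewrite inE; apply/bigcupP.
    have := valP v; rewrite !inE => /orP[/orP[]|] vX.
    - by exists (pre A); rewrite !inE ?eqxx ?orbT.
    - by exists (pre B); rewrite !inE ?eqxx ?orbT.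
    - by exists (pre C); rewrite !inE ?eqxx ?orbT.
  exists (pre A), (pre B), (pre C); split=> //.
    rewrite /= !inE negb_or andbT -andbA; apply/and3P; split.
    - by apply: contraNneq nAB => E; rewrite -AD E BD.
    - by apply: contraNneq nAC => E; rewrite -AD E CD.
    - by apply: contraNneq nBC => E; rewrite -BD E CD.
  apply/subsetP=> v; have /subsetP/(_ (val v)) := ABC.
  by rewrite !inE.
exists val; split; first split=> [|e /= eF].
- exact: val_inj.
- by rewrite inE card_imset ?unif //; apply: val_inj.
move=> e e' /=; rewrite !inE => /orP[/orP[]|] /eqP -> /orP[/orP[]|] /eqP ->;
  rewrite ?AD ?BD ?CD // => /eqP; rewrite 1?eq_sym ?(negPf nAB) ?(negPf nAC) ?(negPf nBC) //;
  by rewrite 1?eq_sym ?(negPf nAB) ?(negPf nAC) ?(negPf nBC).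
Qed.

Definition hub (p : nat) (H : pgraph p) (K : finType)
    (c : {set vertex H} -> K) (k0 : K) : Prop :=
  {in edges H &, forall A B, c A <> c B -> c A <> k0 -> c B <> k0 ->
     [disjoint A & B]}.

(** Two of the edges of a rainbow triangle [A], [B], [C] avoid the hub, hence are
    disjoint. If they are [A] and [B], then [A :|: B] is contained in [C].
    If they are, say, [A] and [C], then [A :\: B] is contained in [C] and
    disjoint from it, so [A] is contained in [B]. Both contradict that the
    edges are distinct and of equal size. *)
Lemma hub_rainbow_free (p : nat) (H : pgraph p) (K : finType)
    (c : {set vertex H} -> K) (k0 : K) :
  0 < p -> hub c k0 -> rainbow_free (@triangle_family p) c.
Proof.
move=> p_gt0 hubc F [_ [A [B [C [uABC EF ABC]]]]] [f [[f_inj fE] c_inj]].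
have [AF BF CF] : [/\ A \in edges F, B \in edges F & C \in edges F].
  by rewrite EF !inE !eqxx !orbT.
have [fA fB fC] : [/\ f @: A \in edges H, f @: B \in edges H & f @: C \in edges H].
  by split; apply: fE.
move: uABC; rewrite /= !inE negb_or andbT => /andP[/andP[/eqP nAB /eqP nAC] /eqP nBC].
have neq X Y : X \in edges F -> Y \in edges F -> X <> Y -> c (f @: X) <> c (f @: Y).
  by move=> XF YF nXY E; apply: nXY; apply: c_inj.
have disj X Y : X \in edges F -> Y \in edges F -> X <> Y ->
    c (f @: X) <> k0 -> c (f @: Y) <> k0 -> [disjoint X & Y].
  move=> XF YF nXY nX nY.
  have := hubc _ _ (fE _ XF) (fE _ YF) (neq _ _ XF YF nXY) nX nY.
  rewrite -!setI_eq0 => /eqP E; apply/eqP/setP=> x; rewrite !inE.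
  apply/negbTE; apply/negP=> /andP[xX xY].
  by have /setP/(_ (f x)) := E; rewrite !inE !imset_f.
have sub X Y : X \in edges F -> Y \in edges F -> X <> Y -> ~~ (X \subset Y).
  move=> XF YF nXY; apply/negP=> XY; apply: nXY; apply/eqP.
  by rewrite eqEcard XY !(edges_uniform) // leqnn.
have side X Y : X \in edges F -> Y \in edges F -> X <> Y -> X <> C ->
    X :\: Y \subset C -> c (f @: X) <> k0 -> c (f @: C) = k0.
  move=> XF YF nXY nXC XYC nX; apply/eqP; apply: contraT => /eqP nC.
  have := disj X C XF CF nXC nX nC; rewrite disjoints_subset => /subsetP XC.
  have /negP[] := sub X Y XF YF nXY; apply/subsetP=> x xX.
  apply: contraT => xY; have := XC x xX; rewrite inE.
  by rewrite (subsetP XYC) // !inE xX xY.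
have [ABC1 BAC] : A :\: B \subset C /\ B :\: A \subset C.
  by move: ABC; rewrite subUset => /andP.
have [EA|/eqP nA] := eqVneq (c (f @: A)) k0.
  have nB : c (f @: B) <> k0 by rewrite -EA; apply: neq => //; apply: nesym.
  have EC := side B A BF AF (nesym nAB) nBC BAC nB.
  by apply: (neq A C) => //; rewrite EA EC.
have EC := side A B AF BF nAB nAC ABC1 nA.
have [EB|/eqP nB] := eqVneq (c (f @: B)) k0.
  by apply: (neq B C) => //; rewrite EB EC.
have := disj A B AF BF nAB nA nB; rewrite -setI_eq0 => /eqP AB0.
have ABC2 : A :|: B \subset C.
  have -> : A :|: B = symdiff A B.
    apply/setP=> x; have /setP/(_ x) := AB0; rewrite !inE.
    by case: (x \in A); case: (x \in B).
  exact: ABC.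
by have /negP[] := sub A C AF CF nAC; rewrite (subset_trans _ ABC2) ?subsetUl.
Qed.

Lemma hub_of_rainbow_free (n p : nat) (K : finType)
    (c : {set vertex (complete n p)} -> K) : 2 < p -> p < n ->
  rainbow_free (@triangle_family p) c -> exists k0, hub c k0.
Proof.
move=> p3 pn /rainbow_free_triangle_free free.
have [|k0 H] := hub_exists free p3; first by rewrite card_ord.
exists k0 => A B; rewrite !inE => /eqP Ap /eqP Bp; exact: H.
Qed.

(** * Counting colors *)

Lemma hub_matching (p : nat) (H : pgraph p) (K : finType)
    (c : {set vertex H} -> K) (k0 : K) : edge_coloring c -> hub c k0 ->
  exists M : {set {set vertex H}},
    [/\ M \subset edges H, {in M, forall e, c e != k0},
        {in M &, forall A B : {set vertex H}, A != B -> [disjoint A & B]},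
        {in M &, injective c} & #|M|.+1 = #|K|].
Proof.
move=> onto hubc.
have [r rE rc] := fin_all_exists2 onto.
exists [set r k | k in [set~ k0]]; split.
- by apply/subsetP=> _ /imsetP[k _ ->].
- by move=> _ /imsetP[k kk0 ->]; move: kk0; rewrite rc !inE.
- move=> _ _ /imsetP[k kk0 ->] /imsetP[l lk0 ->] nkl.
  move: kk0 lk0; rewrite !inE => /eqP kk0 /eqP lk0.
  apply: hubc; rewrite ?rc //.
  by move=> E; rewrite E eqxx in nkl.
- by move=> _ _ /imsetP[k _ ->] /imsetP[l _ ->]; rewrite !rc => ->.
rewrite card_in_imset; last by move=> k l _ _ E; rewrite -(rc k) E rc.
by rewrite cardsC1 prednK //; apply/card_gt0P; exists k0.
Qed.

Lemma card_cover_matching (p : nat) (H : pgraph p) (M : {set {set vertex H}}) :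
  M \subset edges H ->
  {in M &, forall A B : {set vertex H}, A != B -> [disjoint A & B]} ->
  #|cover M| = p * #|M|.
Proof.
move=> ME disj; have /trivIsetP/eqP <- := disj.
rewrite (eq_bigr (fun=> p)) ?sum_nat_const 1?mulnC // => e eM.
by apply: edges_uniform; apply: (subsetP ME).
Qed.

Lemma card_colors_le (n p : nat) (K : finType)
    (c : {set vertex (complete n p)} -> K) : 2 < p -> p < n ->
  edge_coloring c -> rainbow_free (@triangle_family p) c -> #|K| <= 1 + n %/ p.
Proof.
move=> p3 pn onto /hub_of_rainbow_free[] // k0 hubc.
have [M [ME _ disj _ <-]] := hub_matching onto hubc.
rewrite add1n ltnS leq_divRL ?(leq_trans _ p3) // mulnC.
by rewrite -(card_cover_matching ME disj) -[leqRHS]card_ord max_card.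
Qed.

(** Each point of [e] lies in a member of [M], and by disjointness from the
    other colors that member has the color of [e] unless [e] has the hub color;
    so all points of [e] lie in a single member of [M]. *)
Lemma hub_induced (p : nat) (H : pgraph p) (K : finType)
    (c : {set vertex H} -> K) (k0 : K) (M : {set {set vertex H}}) :
  0 < p -> hub c k0 -> M \subset edges H -> {in M, forall e, c e != k0} ->
  {in M &, injective c} ->
  forall e, e \in induced_edges (cover M) -> e \notin M -> c e = k0.
Proof.
move=> p_gt0 hubc ME Mk0 Minj e; rewrite inE => /andP[eH eU] eM.
apply/eqP; apply: contraNT eM => /eqP ek0.
have block x : x \in e -> exists2 B, B \in M & x \in B /\ c B = c e.
  move=> xe; have /bigcupP[B BM xB] := subsetP eU x xe.
  exists B => //; split=> //; apply/eqP; apply: contraT => /eqP nBe.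
  have := hubc B e (subsetP ME B BM) eH nBe (elimN eqP (Mk0 B BM)) ek0.
  by rewrite -setI_eq0 => /eqP/setP/(_ x); rewrite !inE xB xe.
have [x xe] : exists x, x \in e.
  by apply/set0Pn; rewrite -card_gt0 (edges_uniform eH).
have [B BM [_ cB]] := block x xe.
have eB : e \subset B.
  apply/subsetP=> y ye; have [B' B'M [yB' cB']] := block y ye.
  by rewrite (Minj B B') // cB cB'.
suff -> : e = B by [].
apply/eqP; rewrite eqEcard eB !edges_uniform ?leqnn //.
exact: (subsetP ME).
Qed.

(** * The extremal coloring *)

Definition block (n p i : nat) : {set 'I_n} := [set x : 'I_n | x %/ p == i].

Lemma card_block (n p i : nat) : 0 < p -> i < n %/ p -> #|block n p i| = p.
Proof.
move=> p_gt0 ip.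
have bound (j : 'I_p) : i * p + j < n.
  apply: leq_trans (leq_trunc_div n p); rewrite -ltn_divLR //.
  by rewrite divnMDl // divn_small // addn0.
have -> : block n p i = [set Ordinal (bound j) | j in 'I_p].
  apply/setP=> x; rewrite inE; apply/eqP/imsetP=> [xi|[j _ ->]].
    exists (Ordinal (ltn_pmod x p_gt0)) => //.
    by apply: val_inj; rewrite /= -xi -divn_eq.
  by rewrite /= divnMDl // divn_small // addn0.
by rewrite card_imset ?card_ord // => j k [/addnI/val_inj].
Qed.

Definition block_coloring (n p : nat) (e : {set 'I_n}) : option 'I_(n %/ p) :=
  [pick i : 'I_(n %/ p) | e == block n p i].

Lemma block_coloringP (n p : nat) (e : {set 'I_n}) (i : 'I_(n %/ p)) :
  block_coloring p e = Some i -> e = block n p i.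
Proof. by rewrite /block_coloring; case: pickP => // j /eqP -> [->]. Qed.

(** The color [None] is attained because an edge through the vertices [0] and
    [p] cannot be a block. *)
Lemma block_coloring_onto (n p : nat) : 1 < p -> p < n ->
  edge_coloring (H := complete n p) (@block_coloring n p).
Proof.
move=> p_gt1 pn; have p_gt0 := ltnW p_gt1; case=> [i|].
  have Bp := @card_block n p i p_gt0 (ltn_ord i).
  exists (block n p i); first by rewrite inE Bp.
  rewrite /block_coloring; case: pickP => [j /eqP Eij|/(_ i)]; last by rewrite eqxx.
  have [x xB] : exists x, x \in block n p i by apply/set0Pn; rewrite -card_gt0 Bp.
  congr Some; apply: val_inj => /=.
  have := xB; rewrite Eij inE => /eqP <-.
  by move: xB; rewrite inE => /eqP.
have n0 : 0 < n by apply: leq_ltn_trans pn.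
pose x0 := Ordinal n0; pose xp := Ordinal pn.
have [|e De ep] := @exists_superset_card 'I_n [set x0; xp] p.
  rewrite card_ord (ltnW pn) andbT cards2; apply: leq_trans p_gt1.
  by case: eqP.
exists e; first by rewrite inE ep.
rewrite /block_coloring; case: pickP => // j /eqP E.
have := subsetP De x0; have := subsetP De xp; rewrite E !inE !eqxx orbT /=.
by rewrite div0n divnn p_gt0 => /(_ isT)/eqP <- /(_ isT).
Qed.

Lemma block_coloring_hub (n p : nat) :
  hub (H := complete n p) (@block_coloring n p) None.
Proof.
move=> A B _ _; case EA: block_coloring => [i|] //; case EB: block_coloring => [j|] //.
move=> nij _ _; rewrite (block_coloringP EA) (block_coloringP EB) -setI_eq0.
apply/eqP/setP=> x; rewrite !inE; apply/negbTE/negP=> /andP[/eqP xi /eqP xj].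
by apply: nij; congr Some; apply: val_inj; rewrite /= -xi -xj.
Qed.

(** * The anti-Ramsey number and the extremal colorings *)

Theorem theorem1p2 (n p : nat) (hn : p + 1 <= n) (hp : 3 <= p) :
  is_anti_ramsey n (@triangle_family p) (1 + n %/ p) /\
  (forall (K : finType) (c : {set vertex (complete n p)} -> K),
     edge_coloring c -> rainbow_free (@triangle_family p) c ->
     is_anti_ramsey n (@triangle_family p) #|K| ->
     exists U : {set vertex (complete n p)},
       #|U| = p * (n %/ p) /\
       exists (M : {set {set vertex (complete n p)}}) (k0 : K),
         [/\ M \subset induced_edges U, #|M| = n %/ p,
             {in M &, forall A B : {set vertex (complete n p)}, A != B -> [disjoint A & B]},
             {in M &, injective c} &
             (forall e, e \in M -> c e != k0) /\
             (forall e, e \in induced_edges U -> e \notin M -> c e = k0)]).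
Proof.
have pn : p < n by rewrite -addn1.
have p_gt0 : 0 < p := leq_trans (isT : 0 < 3) hp.
have lower : exists (K : finType) (c : {set vertex (complete n p)} -> K),
    [/\ edge_coloring c, rainbow_free (@triangle_family p) c & #|K| = 1 + n %/ p].
  exists (option 'I_(n %/ p) : finType), (@block_coloring n p); split.
  - exact: block_coloring_onto (ltnW hp) pn.
  - exact: hub_rainbow_free p_gt0 (@block_coloring_hub n p).
  - by rewrite card_option card_ord.
split; first by split=> // K c; apply: card_colors_le.
move=> K c onto free [_ maxK].
have cardK : #|K| = (n %/ p).+1.
  have [K' [c' [onto' free' cardK']]] := lower.
  apply/eqP; rewrite eqn_leq -add1n (card_colors_le hp pn onto free) -cardK'.
  exact: maxK onto' free'.
have [k0 hubc] := hub_of_rainbow_free hp pn free.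
have [M [ME Mk0 disj Minj]] := hub_matching onto hubc.
rewrite cardK => -[cardM].
exists (cover M); rewrite (card_cover_matching ME disj) cardM; split=> //.
exists M, k0; split=> //.
  apply/subsetP=> e eM; rewrite inE (subsetP ME) //.
  by apply/subsetP=> x xe; apply/bigcupP; exists e.
by split=> // e; apply: hub_induced Minj e.
Qed.
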